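(* Let $v$ be a (twice differentiable) solution of the Hamilton–Jacobi–Bellman equation $$\rho v(x)=\max_{\theta\in\mathcal P(U)}\Big(\tilde r(x,\theta)-\lambda\int_U\theta(u)\ln\theta(u)\,du+\tilde\sigma^2(x,\theta)\,\widetilde G[v''(x)]+\tilde b(x,\theta)v'(x)\Big),\qquad x\in\mathbb R,$$ equivalently $$\rho v(x)=\max_{\theta\in\mathcal P(U)}\int_U\Big(r(x,u)-\lambda\ln\theta(u)+\sigma^2(x,u)\widetilde G[v''(x)]+b(x,u)v'(x)\Big)\theta(u)\,du,\qquad x\in\mathbb R .$$ Then for each $x\in\mathbb R$ the constrained maximization problem on the right-hand side, over $\theta\in\mathcal P(U)$, admits a unique solution, given by the randomized feedback control $$\boldsymbol\theta^*(u;x)=\frac{\exp\big(\tfrac1\lambda\Psi(x,u)\big)}{\int_U\exp\big(\tfrac1\lambda\Psi(x,u')\big)\,du'},\qquad \Psi(x,u)=r(x,u)+\sigma^2(x,u)\widetilde G[v''(x)]+b(x,u)v'(x).$$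
   Context: $U$ is the action space, a Borel subset of a Euclidean space of positive Lebesgue measure. $b,\sigma,r:\mathbb R\times U\to\mathbb R$ are given measurable functions (drift, volatility, reward); $\rho>0$ is a discount rate and $\lambda>0$ an exploration weight; $0<\underline\sigma\le\overline\sigma<\infty$ are volatility bounds. $\mathcal P(U)$ is the set of probability densities on $U$ with respect to Lebesgue measure: $\theta\in\mathcal P(U)$ iff $\int_U\theta(u)\,du=1$ and $\theta(u)\ge0$ a.e. on $U$. In the maximization, integrals are understood over those $\theta$ for which they are well defined, and uniqueness is up to equality Lebesgue-a.e. Exploratory coefficients: $\tilde b(x,\theta)=\int_U b(x,u)\theta(u)\,du$, $\tilde\sigma(x,\theta)=\sqrt{\int_U\sigma^2(x,u)\theta(u)\,du}$, $\tilde r(x,\theta)=\int_U r(x,u)\theta(u)\,du$. For a real number $a$, $\widetilde G[a]:=\tfrac12(\underline\sigma^2a^+-\overline\sigma^2a^-)$ with $a^+=\max(a,0)$, $a^-=\max(-a,0)$ (this equals $\frac12\mathcal E[aB(1)^2]$, where $B$ is a $G$-Brownian motion with $B(1)\sim\mathcal N(0,[\underline\sigma^2,\overline\sigma^2])$ and $\mathcal E[X]=-\hat{\mathbb E}[-X]$ is the lower expectation). *)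

(* Defs.v *)
From HB Require Import structures.
From mathcomp Require Import all_boot all_order all_algebra.
From mathcomp Require Import all_classical all_reals all_analysis.

Set Implicit Arguments.
Unset Strict Implicit.
Unset Printing Implicit Defensive.

Import Order.TTheory GRing.Theory Num.Theory.
Import numFieldNormedType.Exports.

Local Open Scope ring_scope.
Local Open Scope classical_set_scope.

(* Euclidean space R^n is [n.-tuple (measurableTypeR R)]: its sigma-algebra is
   generated by the coordinate projections, i.e. it is the Borel one. *)
Notation euclidean R n := (n.-tuple (measurableTypeR R)).

Section lebesgue_measure_on_tuples.
Context {R : realType}.
Local Open Scope ereal_scope.

Section cons.
Variable n : nat.
Variable mu : {sigma_finite_measure set (euclidean R n) -> \bar R}.

Definition cons_pair (p : measurableTypeR R * euclidean R n) :
    euclidean R n.+1 := [the n.+1.-tuple _ of p.1 :: p.2].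

Lemma measurable_cons_pair : measurable_fun setT cons_pair.
Proof.
exact: (@measurable_cons _ _ _ _ fst n snd measurable_fst measurable_snd).
Qed.

Definition lebesgue_cons : set (euclidean R n.+1) -> \bar R :=
  pushforward (@lebesgue_measure R \x mu) cons_pair.

Let lebesgue_cons0 : lebesgue_cons set0 = 0.
Proof. by rewrite /lebesgue_cons /pushforward preimage_set0 measure0. Qed.

Let lebesgue_cons_ge0 A : 0 <= lebesgue_cons A.
Proof. by rewrite /lebesgue_cons /pushforward measure_ge0. Qed.

Let lebesgue_cons_sigma_additive : semi_sigma_additive lebesgue_cons.
Proof.
move=> F mF tF mUF; rewrite /lebesgue_cons /pushforward preimage_bigcup.
have mpre B : measurable B -> measurable (cons_pair @^-1` B).
  by move=> mB; rewrite -[X in measurable X]setTI; exact: measurable_cons_pair.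
apply: measure_semi_sigma_additive.
- by move=> k; exact: mpre.
- apply/trivIsetP => /= i j _ _ ij; rewrite -preimage_setI.
  by move/trivIsetP : tF => /(_ _ _ _ _ ij) ->//; rewrite preimage_set0.
- by rewrite -preimage_bigcup; exact: mpre.
Qed.

HB.instance Definition _ := isMeasure.Build _ _ _ lebesgue_cons
  lebesgue_cons0 lebesgue_cons_ge0 lebesgue_cons_sigma_additive.

Let lebesgue_cons_sigma_finite : sigma_finite setT lebesgue_cons.
Proof.
have /sigma_finiteP[F [TF ndF Foo]] := sigma_finiteT (@lebesgue_measure R).
have /sigma_finiteP[G [TG ndG Goo]] := sigma_finiteT mu.
pose uncons (t : euclidean R n.+1) : measurableTypeR R * euclidean R n :=
  (thead t, [tuple of behead t]).
have consK : cancel cons_pair uncons.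
  by move=> [x t]; rewrite /uncons /= theadE; congr pair; exact/val_inj.
have muncons : measurable_fun setT uncons.
  apply/measurable_fun_pair; last exact: measurable_behead.
  exact: measurable_tnth.
exists (fun k => uncons @^-1` (F k `*` G k)).
  apply/esym; rewrite -subTset => t _.
  have [i _ Fi] : (\bigcup_i F i) (uncons t).1 by rewrite -TF.
  have [j _ Gj] : (\bigcup_i G i) (uncons t).2 by rewrite -TG.
  exists (maxn i j) => //; split.
    by move: Fi; exact/subsetPset/ndF/leq_maxl.
  by move: Gj; exact/subsetPset/ndG/leq_maxr.
move=> k; have [mF Fk] := Foo k; have [mG Gk] := Goo k; split.
  by rewrite -[X in measurable X]setTI; apply: muncons => //; exact: measurableX.
rewrite /lebesgue_cons /pushforward -comp_preimage.
rewrite (_ : uncons \o cons_pair = idfun); last first.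
  by apply/funext => p; exact: consK.
by rewrite preimage_id product_measure1E// lte_mul_pinfty// ge0_fin_numE.
Qed.

HB.instance Definition _ := Measure_isSigmaFinite.Build _ _ _ lebesgue_cons
  lebesgue_cons_sigma_finite.

End cons.

(* Lebesgue measure on R^n, as an iterated product: the image of
   [lebesgue_measure \x lebesgue_tuple n] under (x, t) |-> x :: t. *)
Fixpoint lebesgue_tuple (n : nat) :
    {sigma_finite_measure set (euclidean R n) -> \bar R} :=
  match n with
  | 0 => \d_([tuple] : euclidean R 0)
  | n'.+1 => lebesgue_cons (lebesgue_tuple n')
  end.

Lemma lebesgue_tuple_box n (A : 'I_n -> set (measurableTypeR R)) :
  (forall i, measurable (A i)) ->
  lebesgue_tuple n [set t | forall i, A i (tnth t i)] =
  \prod_(i < n) lebesgue_measure (A i).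
Proof.
elim: n A => [|n IH] A mA.
  rewrite big_ord0 /= diracE mem_set//=.
  by case.
rewrite big_ord_recl /= /lebesgue_cons /pushforward.
rewrite -(IH (fun i => A (lift ord0 i)))//.
rewrite -product_measure1E//; last first.
  rewrite (_ : mkset _ =
      \bigcap_(i in [set: 'I_n]) (@tnth n _ ^~ i @^-1` A (lift ord0 i))).
    apply: fin_bigcap_measurable => // i _.
    by rewrite -[X in measurable X]setTI; exact: measurable_tnth.
  by apply/seteqP; split => [t /= + i _ | t /= + i]; exact.
congr (_ _); apply/seteqP; split => -[x t] /=.
  move=> h; split; first exact: (h ord0).
  by move=> i; have := h (lift ord0 i); rewrite tnthS.
move=> [h0 h] i; case: (unliftP ord0 i) => [j|] ->//.
by rewrite tnthS; exact: h.
Qed.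

End lebesgue_measure_on_tuples.

Section optimization.
Context {T : Type} {R : realType}.
Variables (adm : set T) (J : T -> \bar R).

Definition is_maximizer (t : T) : Prop :=
  adm t /\ forall t', adm t' -> (J t' <= J t)%E.

(* [m] is the (attained) maximum of [J] over [adm] *)
Definition is_max (m : \bar R) : Prop := exists2 t, is_maximizer t & J t = m.

End optimization.

Section exploratory.
Context {R : realType} {n : nat}.
Variable U : set (euclidean R n).
Local Notation mu := (@lebesgue_tuple R n).
Implicit Types theta : euclidean R n -> R.

(* The integral of [f] over [U] is meaningful, possibly infinite: not of the
   form oo - oo. *)
Definition integral_defined (f : euclidean R n -> R) : Prop :=
  measurable_fun U f /\
  ((\int[mu]_(u in U) ((f^\+)%R u)%:E < +oo)%E \/
   (\int[mu]_(u in U) ((f^\-)%R u)%:E < +oo)%E).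

(* P(U); only the values of [theta] on [U] matter *)
Definition density : set (euclidean R n -> R) :=
  [set theta : euclidean R n -> R | [/\ measurable_fun U theta,
    {ae mu, forall u, U u -> 0 <= theta u} &
    (\int[mu]_(u in U) (theta u)%:E = 1)%E]].

Definition ae_unique_maximizer (adm : set (euclidean R n -> R))
    (J : (euclidean R n -> R) -> \bar R) (theta : euclidean R n -> R) : Prop :=
  is_maximizer adm J theta /\
  forall theta', is_maximizer adm J theta' ->
    {ae mu, forall u, U u -> theta' u = theta u}.

Variables (b sigma r : R -> euclidean R n -> R).

Definition tilde_b (x : R) theta : \bar R :=
  (\int[mu]_(u in U) (b x u * theta u)%:E)%E.

Definition tilde_sigma (x : R) theta : \bar R :=
  sqrte (\int[mu]_(u in U) (sigma x u ^+ 2 * theta u)%:E)%E.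

Definition tilde_r (x : R) theta : \bar R :=
  (\int[mu]_(u in U) (r x u * theta u)%:E)%E.

(* [ln 0 = 0], which gives the convention 0 ln 0 = 0 *)
Definition int_theta_ln_theta theta : \bar R :=
  (\int[mu]_(u in U) (theta u * ln (theta u))%:E)%E.

Variables (slo shi rho lambda : R).

Definition tilde_G (a : R) : R :=
  2^-1 * (slo ^+ 2 * Num.max a 0 - shi ^+ 2 * Num.max (- a) 0).

Variable v : R -> R.

Definition Psi (x : R) (u : euclidean R n) : R :=
  r x u + sigma x u ^+ 2 * tilde_G (derive1n 2 v x) + b x u * derive1 v x.

Definition theta_star (x : R) (u : euclidean R n) : R :=
  expR (lambda^-1 * Psi x u) /
  \int[mu]_(u' in U) expR (lambda^-1 * Psi x u').

Section separate_integrals.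
Variables (x : R) (theta : euclidean R n -> R).
Local Open Scope ereal_scope.

Let term_r := tilde_r x theta.
Let term_ent := - (lambda%:E * int_theta_ln_theta theta).
Let term_sigma := tilde_sigma x theta ^+ 2 * (tilde_G (derive1n 2 v x))%:E.
Let term_b := tilde_b x theta * (derive1 v x)%:E.

Definition hjb_coef : \bar R := term_r + term_ent + term_sigma + term_b.

(* All four integrals are meaningful, and so is their combination:
   [x +? y] excludes oo - oo. *)
Definition coef_defined : Prop :=
  [/\ integral_defined (fun u => r x u * theta u)%R,
      integral_defined (fun u => theta u * ln (theta u))%R,
      integral_defined (fun u => sigma x u ^+ 2 * theta u)%R,
      integral_defined (fun u => b x u * theta u)%R &
      [&& term_r +? term_ent,
          (term_r + term_ent) +? term_sigma &
          (term_r + term_ent + term_sigma) +? term_b]].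

End separate_integrals.

Definition adm_coef (x : R) : set (euclidean R n -> R) :=
  [set theta : euclidean R n -> R | density theta /\ coef_defined x theta].

Definition hjb_integrand (x : R) theta (u : euclidean R n) : R :=
  (r x u - lambda * ln (theta u) + sigma x u ^+ 2 * tilde_G (derive1n 2 v x)
   + b x u * derive1 v x) * theta u.

Definition hjb_int (x : R) theta : \bar R :=
  (\int[mu]_(u in U) (hjb_integrand x theta u)%:E)%E.

Definition adm_int (x : R) : set (euclidean R n -> R) :=
  [set theta : euclidean R n -> R | density theta /\ integral_defined (hjb_integrand x theta)].

Definition twice_differentiable : Prop :=
  (forall x, derivable v x 1) /\ (forall x, derivable (derive1 v) x 1).

(* Two forms of the Hamilton-Jacobi-Bellman equation: with the
   exploratory coefficients, and with a single integral. Each maximum is over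
   the densities for which the integrals in that form are meaningful. *)
Definition HJB_coef : Prop :=
  forall x, is_max (adm_coef x) (hjb_coef x) (rho * v x)%:E.

Definition HJB_int : Prop :=
  forall x, is_max (adm_int x) (hjb_int x) (rho * v x)%:E.

End exploratory.

(* Main.v *)
(** With p = exp(Psi / lambda) and Z the integral of p over U, concavity of the
logarithm gives the Gibbs inequality
  (Psi - lambda ln theta) theta <= lambda (ln Z) theta + lambda (p / Z - theta),
with equality only where theta = p / Z. Integrating, the objective is at most
lambda ln Z on densities, with equality only for theta_star = p / Z.

That Z is finite is a consequence of the HJB equation. On sets E_k of finite
measure where the coefficients are bounded, increasing to U, the truncated
densities p 1_(E_k) / Z_k are admissible with objective lambda ln Z_k. Hence
lambda ln Z_k <= rho v(x), and Z <= exp(rho v(x) / lambda) by monotone convergence.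

For the form with separate coefficients, a finite value makes each of the four
terms finite, so that the two objectives agree at a maximizer. It is therefore
a.e. equal to theta_star, which is thus admissible. *)
Require Import Defs.
From HB Require Import structures.
From mathcomp Require Import all_boot all_order all_algebra.
From mathcomp Require Import all_classical all_reals all_analysis.
From mathcomp Require Import measurable_realfun ring lra.
Import Order.TTheory GRing.Theory Num.Theory.
Import numFieldNormedType.Exports.
Local Open Scope ring_scope.
Local Open Scope classical_set_scope.

(** * Comparison of integrals and criteria for integrability *)

Lemma ae_le_integral {d} {T : measurableType d} {R : realType}
    {mu : {measure set T -> \bar R}} {D : set T} (f g : T -> \bar R) :
  measurable D -> measurable_fun D f -> measurable_fun D g ->
  {ae mu, forall u, D u -> (f u <= g u)%E} ->
  (\int[mu]_(u in D) f u <= \int[mu]_(u in D) g u)%E.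
Proof.
move=> mD mf mg fg.
(* Positive parts increase and negative parts decrease. Subtraction of extended reals is monotone
   even with the convention oo - oo = -oo, so the integrals may be infinite. *)
rewrite integralE [leRHS]integralE; apply: leeB.
- apply: ae_ge0_le_integral => //.
  + exact: measurable_funepos.
  + exact: measurable_funepos.
  + apply: filterS fg => u /= fgu Du; rewrite !funeposE.
    by rewrite ge_max !le_max lexx orbT fgu.
- apply: ae_ge0_le_integral => //.
  + exact: measurable_funeneg.
  + exact: measurable_funeneg.
  + apply: filterS fg => u /= fgu Du; rewrite !funenegE.
    by rewrite ge_max !le_max lexx orbT leeN2 fgu.
Qed.

(** The difference [g - f] is a.e. nonnegative with integral zero, hence a.e. zero. This is the
    source of the uniqueness of maximizers. *)
Lemma ae_eq_of_le_integral {d} {T : measurableType d} {R : realType}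
    {mu : {measure set T -> \bar R}} {D : set T} (f g : T -> R) :
  measurable D -> mu.-integrable D (EFin \o f) -> mu.-integrable D (EFin \o g) ->
  {ae mu, forall u, D u -> f u <= g u} ->
  (\int[mu]_(u in D) (f u)%:E = \int[mu]_(u in D) (g u)%:E)%E ->
  {ae mu, forall u, D u -> f u = g u}.
Proof.
move=> mD If Ig fg eqfg.
have Igf : mu.-integrable D (fun u => (g u)%:E - (f u)%:E)%E.
  exact: (integrableB mD Ig If).
have mgf := measurable_int _ Igf.
have : (\int[mu]_(u in D) `|(g u)%:E - (f u)%:E| = 0)%E.
  transitivity (\int[mu]_(u in D) ((g u)%:E - (f u)%:E))%E.
    apply: ae_eq_integral => //; first exact: measurableT_comp.
    by apply: filterS fg => u /= fgu /fgu ?; rewrite ger0_norm// subr_ge0.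
  by rewrite (integralB_EFin mD Ig If) eqfg subee// integrable_fin_num.
move/(ae_eq_integral_abs mu mD mgf); apply: filterS => u /= gf0 Du.
by move: (gf0 Du) => -[] /eqP; rewrite subr_eq0 => /eqP.
Qed.

(** The integral is the difference of those of the positive and negative parts, and oo - oo
    evaluates to -oo; a finite value therefore forces both parts to be finite. *)
Lemma integrable_of_integral_fin_num {d} {T : measurableType d} {R : realType}
    {mu : {measure set T -> \bar R}} {D : set T} (f : T -> R) :
  measurable D -> measurable_fun D f ->
  (\int[mu]_(u in D) (f u)%:E)%E \is a fin_num -> mu.-integrable D (EFin \o f).
Proof.
move=> mD mf fin; apply/integrableP; split; first exact/measurable_EFinP.
by rewrite integral_fin_num_abs.
Qed.

Lemma integrable_bounded_support {d} {T : measurableType d} {R : realType}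
    {mu : {measure set T -> \bar R}} {D E : set T} (f : T -> R) (c : R) :
  measurable D -> measurable E -> E `<=` D -> (mu E < +oo)%E ->
  measurable_fun D f -> (forall u, D u -> `|f u| <= c * \1_E u) ->
  mu.-integrable D (EFin \o f).
Proof.
move=> mD mE ED muE mf fc.
apply: (@le_integrable _ _ _ mu D mD _ (fun u => (c%:E * (\1_E u)%:E)%E)).
- exact/measurable_EFinP.
- move=> u Du /=; rewrite lee_fin; apply: le_trans (fc u Du) _.
  exact: ler_norm.
- apply: integrableZl => //.
  apply: (@integrable_of_integral_fin_num _ _ _ mu D (\1_E)) => //.
  by rewrite integral_indic// setIidl// ge0_fin_numE.
Qed.

(** * The Gibbs inequality and entropy-regularized payoffs *)

Lemma gibbs_ln_le {R : realType} (p q : R) : 0 <= p -> 0 < q ->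
  p * (ln q - ln p) <= q - p ?= iff (p == q).
Proof.
(* At [p = 0] the factor [p] kills the logarithm, whatever the value given to [ln 0]. *)
move=> p0 q0; have [->|pn0] := eqVneq p 0.
  by split; rewrite mul0r subr0 ?ltW// eq_sym.
have pp : 0 < p by rewrite lt_neqAle eq_sym pn0.
have [->|pq] := eqVneq p q; first by split; rewrite ?subrr ?mulr0// eqxx.
have lnn0 : ln q - ln p != 0.
  by apply: contra pq; rewrite subr_eq0 => /eqP/ln_inj -> //; rewrite posrE.
suff h : p * (ln q - ln p) < q - p by split; [exact: ltW | rewrite lt_eqF].
(* The strict inequality 1 + t < exp t at t = [ln q - ln p], which is nonzero, reads 1 + t < q / p;
   multiplying by [p] gives the claim. *)
have := expR_gt1Dx lnn0; rewrite expRB !lnK ?posrE//.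
rewrite ltr_pdivlMr// => h; lra.
Qed.

Section gibbs.
Context {d : measure_display} {T : measurableType d} {R : realType}.
Variables (mu : {measure set T -> \bar R}) (D : set T).
Variables (psi : T -> R) (lambda : R).
Hypotheses (mD : measurable D) (mpsi : measurable_fun D psi).
Hypothesis lambda_gt0 : 0 < lambda.

(** The unnormalized Gibbs density of [psi] at temperature [lambda]; its integral is the partition
    function. *)
Definition gibbs_weight (u : T) : R := expR (lambda^-1 * psi u).

Definition entropic_payoff (theta : T -> R) (u : T) : R :=
  (psi u - lambda * ln (theta u)) * theta u.

Lemma gibbs_weight_gt0 u : 0 < gibbs_weight u.
Proof. exact: expR_gt0. Qed.

Lemma measurable_gibbs_weight : measurable_fun D gibbs_weight.
Proof. by apply: measurableT_comp => //; exact: measurable_funM. Qed.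

Lemma measurable_entropic_payoff theta : measurable_fun D theta ->
  measurable_fun D (entropic_payoff theta).
Proof.
move=> mtheta; apply: measurable_funM => //; apply: measurable_funB => //.
by apply: measurable_funM => //; exact: measurableT_comp.
Qed.

(* Integrates to [lambda * ln c] when [c] is the total weight and [theta] is a
   density. *)
Definition gibbs_bound (c : R) (theta : T -> R) (u : T) : R :=
  lambda * (ln c - 1) * theta u + lambda / c * gibbs_weight u.

(** With q = [gibbs_weight u / c] one has [psi u] = lambda ln q + lambda ln c. After this
    substitution, both sides are [lambda * ln c * theta u] plus [lambda] times the two sides of
    [gibbs_ln_le] at [theta u] and q. As [lambda] is positive, the equality case carries over
    too. *)
Lemma entropic_payoff_le (c : R) (theta : T -> R) (u : T) : 0 < c -> 0 <= theta u ->
  entropic_payoff theta u <= gibbs_bound c theta u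
    ?= iff (theta u == gibbs_weight u / c).
Proof.
move=> c0 t0.
have q0 : 0 < gibbs_weight u / c by rewrite divr_gt0 ?gibbs_weight_gt0.
have [le eq] := gibbs_ln_le _ _ t0 q0.
have psiE : psi u = lambda * ln (gibbs_weight u / c) + lambda * ln c.
  rewrite ln_div ?posrE ?gibbs_weight_gt0// expRK; field.
  by rewrite gt_eqF.
have payoffE : entropic_payoff theta u = lambda * ln c * theta u +
    lambda * (theta u * (ln (gibbs_weight u / c) - ln (theta u))).
  by rewrite /entropic_payoff psiE; ring.
have boundE : gibbs_bound c theta u =
    lambda * ln c * theta u + lambda * (gibbs_weight u / c - theta u).
  by rewrite /gibbs_bound; field; rewrite gt_eqF.
rewrite payoffE boundE; split; first by rewrite lerD2l ler_pM2l.
by rewrite (inj_eq (addrI _)) -eq; apply/inj_eq/mulfI; rewrite gt_eqF.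
Qed.

Section normalized.
Variables (c : R) (theta : T -> R).
Hypotheses (c_gt0 : 0 < c).
Hypothesis intw : (\int[mu]_(u in D) (gibbs_weight u)%:E = c%:E)%E.
Hypothesis mtheta : measurable_fun D theta.
Hypothesis theta_ge0 : {ae mu, forall u, D u -> 0 <= theta u}.
Hypothesis int_theta : (\int[mu]_(u in D) (theta u)%:E = 1)%E.

Let Iw : mu.-integrable D (EFin \o gibbs_weight).
Proof.
apply: integrable_of_integral_fin_num => //; last by rewrite intw.
exact: measurable_gibbs_weight.
Qed.

Let It : mu.-integrable D (EFin \o theta).
Proof.
apply: integrable_of_integral_fin_num => //; by rewrite int_theta.
Qed.

Let integrable_gibbs_bound : mu.-integrable D (EFin \o gibbs_bound c theta).
Proof.
apply: (integrableD mD (integrableZl mD (lambda * (ln c - 1)) It)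
          (integrableZl mD (lambda / c) Iw)).
Qed.

Let integral_gibbs_bound :
  (\int[mu]_(u in D) (gibbs_bound c theta u)%:E = (lambda * ln c)%:E)%E.
Proof.
under eq_integral do rewrite EFinD !EFinM.
rewrite integralD; last 3 first.
- exact: mD.
- exact: (integrableZl mD _ It).
- exact: (integrableZl mD _ Iw).
rewrite (integralZl mD It) (integralZl mD Iw) /= intw int_theta mule1 -EFinM -EFinD.
by congr EFin; field; rewrite gt_eqF.
Qed.

Let ae_payoff_le :
  {ae mu, forall u, D u -> entropic_payoff theta u <= gibbs_bound c theta u}.
Proof.
apply: filterS theta_ge0 => u /= t0 Du.
exact: entropic_payoff_le (t0 Du).
Qed.

(** The pointwise bound is integrated. The payoff may integrate to -oo, so the comparison goes
    through [ae_le_integral], which allows infinite values. *)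
Lemma integral_entropic_payoff_le :
  (\int[mu]_(u in D) (entropic_payoff theta u)%:E <= (lambda * ln c)%:E)%E.
Proof.
rewrite -integral_gibbs_bound; apply: ae_le_integral => //.
- exact/measurable_EFinP/measurable_entropic_payoff.
- exact: measurable_int integrable_gibbs_bound.
Qed.

(** A finite value makes the payoff integrable. Equal integrals then force a.e. equality in the
    pointwise bound, whose equality case identifies [theta]. *)
Lemma integral_entropic_payoff_eq :
  (\int[mu]_(u in D) (entropic_payoff theta u)%:E = (lambda * ln c)%:E)%E ->
  {ae mu, forall u, D u -> theta u = gibbs_weight u / c}.
Proof.
move=> eqJ.
have IJ : mu.-integrable D (EFin \o entropic_payoff theta).
  apply: integrable_of_integral_fin_num => //; last by rewrite eqJ.
  exact: measurable_entropic_payoff.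
have := @ae_eq_of_le_integral _ _ _ _ _ _ _ mD IJ integrable_gibbs_bound
  ae_payoff_le (etrans eqJ (esym integral_gibbs_bound)).
apply: filterS2 theta_ge0 => u t0 eqb Du.
have [_ E] := entropic_payoff_le _ _ _ c_gt0 (t0 Du).
by apply/eqP; rewrite -E (eqb Du).
Qed.

End normalized.

(** On [E] the logarithm of [theta] cancels [psi] up to the constant [lambda * ln c]; off [E] both
    sides vanish. Truncated densities use a bounded piece for [E], and the full Gibbs density uses
    the whole space. *)
Lemma entropic_payoff_gibbs (c : R) (E : set T) (u : T) : 0 < c ->
  let theta := fun u => gibbs_weight u / c * \1_E u in
  entropic_payoff theta u = lambda * ln c * theta u.
Proof.
move=> c0 /=; rewrite /entropic_payoff indicE.
case: (u \in E); rewrite ?mulr0// !mulr1; congr (_ * _).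
rewrite ln_div ?posrE ?gibbs_weight_gt0// expRK; field.
by rewrite gt_eqF.
Qed.

Lemma integral_gibbs_weight_restrict (c : R) (E : set T) : measurable E ->
  E `<=` D -> 0 < c -> (\int[mu]_(u in E) (gibbs_weight u)%:E = c%:E)%E ->
  (\int[mu]_(u in D) (gibbs_weight u / c * \1_E u)%:E = 1)%E.
Proof.
move=> mE ED c0 intE.
transitivity (\int[mu]_(u in D) ((fun u => (c^-1%:E * (gibbs_weight u)%:E)%E) \_ E) u)%E.
  apply: eq_integral => u _; rewrite patchE indicE.
  by case: ifPn => _; rewrite ?mulr1 ?mulr0// mulrC EFinM.
rewrite -integral_mkcondr setIidr// ge0_integralZl_EFin//.
- by rewrite intE -EFinM mulVf// gt_eqF.
- by move=> u _; rewrite lee_fin ltW// gibbs_weight_gt0.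
- apply/measurable_EFinP; apply: measurable_funS measurable_gibbs_weight => //.
- by rewrite invr_ge0 ltW.
Qed.

(** If the integral were zero, the weight would vanish a.e. on [D]; since an exponential never
    vanishes, [D] would be a null set. *)
Lemma integral_gibbs_weight_gt0 : (0 < mu D)%E ->
  (0 < \int[mu]_(u in D) (gibbs_weight u)%:E)%E.
Proof.
move=> muD; rewrite lt0e integral_ge0 ?andbT; last first.
  by move=> u _; rewrite lee_fin ltW// gibbs_weight_gt0.
apply/eqP => int0.
have mw : measurable_fun D (EFin \o gibbs_weight).
  exact/measurable_EFinP/measurable_gibbs_weight.
have : (\int[mu]_(u in D) `|(gibbs_weight u)%:E| = 0)%E.
  rewrite -[RHS]int0; apply: eq_integral => u _.
  by rewrite gee0_abs// lee_fin ltW// gibbs_weight_gt0.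
move/(ae_eq_integral_abs mu mD mw) => [N [mN muN0 DN]].
suff : mu D = 0 by move=> D0; rewrite D0 ltxx in muD.
apply: (subset_measure0 mD mN _ muN0) => u Du; apply: DN => /= /(_ Du) [].
by apply/eqP; rewrite gt_eqF// gibbs_weight_gt0.
Qed.

(** Monotone convergence reduces the bound to each [E k], where [lambda * ln c <= m] is
    exponentiated. *)
Lemma integral_gibbs_weight_le (m : R) (E : (set T)^nat) :
  {homo E : i j / (i <= j)%N >-> (i <= j)%O} ->
  (forall k, measurable (E k)) -> \bigcup_k E k = D ->
  (forall k, (\int[mu]_(u in E k) (gibbs_weight u)%:E < +oo)%E) ->
  (forall k c, 0 < c -> (\int[mu]_(u in E k) (gibbs_weight u)%:E = c%:E)%E ->
    lambda * ln c <= m) ->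
  (\int[mu]_(u in D) (gibbs_weight u)%:E <= (expR (m / lambda))%:E)%E.
Proof.
move=> ndE mE ED finE leE.
have w0 u : (0 <= (gibbs_weight u)%:E)%E by rewrite lee_fin ltW// gibbs_weight_gt0.
have cvgE : (\int[mu]_(u in E k) (gibbs_weight u)%:E)%E @[k --> \oo] -->
    (\int[mu]_(u in D) (gibbs_weight u)%:E)%E.
  rewrite -[X in _ --> (\int[mu]_(u in X) _)%E]ED.
  apply: ge0_nondecreasing_set_cvg_integral => // k.
  apply/measurable_EFinP; apply: measurable_funS measurable_gibbs_weight => //.
  by rewrite -ED; exact: bigcup_sup.
rewrite -(cvg_lim _ cvgE)//; apply: lime_le; first by apply/cvg_ex; eexists; exact: cvgE.
apply: nearW => k.
have int0 : (0 <= \int[mu]_(u in E k) (gibbs_weight u)%:E)%E by exact: integral_ge0.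
have finZ : (\int[mu]_(u in E k) (gibbs_weight u)%:E)%E \is a fin_num.
  by rewrite ge0_fin_numE.
rewrite -(fineK finZ) lee_fin.
(* Some [E k] may be null; the logarithmic bound says nothing there, but an exponential exceeds zero
   anyway. *)
have [c0|c0] := leP (fine (\int[mu]_(u in E k) (gibbs_weight u)%:E)%E) 0.
  by rewrite (le_trans c0)// expR_ge0.
rewrite -[leLHS]lnK ?posrE// ler_expR ler_pdivlMr// mulrC.
by apply: (leE k) => //; rewrite fineK.
Qed.

End gibbs.

(* For [a = 0] the integral of [f] may be infinite, as [oo * 0 = 0]. *)
Lemma integrable_scale {d} {T : measurableType d} {R : realType}
    {mu : {measure set T -> \bar R}} {D : set T} (f : T -> R) (a : R) :
  measurable D -> measurable_fun D f ->
  (\int[mu]_(u in D) (f u)%:E * a%:E)%E \is a fin_num ->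
  mu.-integrable D (EFin \o (fun u => f u * a)) /\
  (\int[mu]_(u in D) (f u * a)%:E = \int[mu]_(u in D) (f u)%:E * a%:E)%E.
Proof.
move=> mD mf; have [->|a0] := eqVneq a 0.
  rewrite mule0 => _; split.
    apply: (eq_integrable mD (cst 0%E)); last exact: integrable0.
    by move=> u _ /=; rewrite mulr0.
  by rewrite (eq_integral (cst 0%E)) ?integral0// => u _; rewrite mulr0.
move=> fin; have intf : mu.-integrable D (EFin \o f).
  apply: integrable_of_integral_fin_num => //.
  by move: fin; case: (\int[mu]_(u in D) (f u)%:E)%E => //;
    rewrite ?mulyr ?mulNyr; case: sgrP a0 => // _ _; rewrite ?mul1e ?mulN1e.
split.
  apply: (eq_integrable mD (fun u => a%:E * (f u)%:E)%E); last exact: integrableZl.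
  by move=> u _ /=; rewrite -EFinM mulrC.
under eq_integral do rewrite mulrC EFinM.
by rewrite (integralZl mD intf) muleC.
Qed.

(** * Relations between the two forms of the HJB objective *)

Section exploratory_control.
Context {R : realType} {n : nat}.
Variables (U : set (euclidean R n)) (b sigma r : R -> euclidean R n -> R).
Variables (slo shi lambda : R) (v : R -> R) (x : R).
Hypothesis mU : measurable U.
Hypotheses (mb : measurable_fun U (b x)) (msigma : measurable_fun U (sigma x))
  (mr : measurable_fun U (r x)).
Hypothesis lambda_gt0 : 0 < lambda.

Local Notation mu := (@lebesgue_tuple R n).
Local Notation psi := (Psi b sigma r slo shi v x).
Local Notation G := (tilde_G slo shi (derive1n 2 v x)).
Local Notation J_coef := (hjb_coef U b sigma r slo shi lambda v x).
Local Notation J_int := (hjb_int U b sigma r slo shi lambda v x).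
Local Notation adm_coef := (adm_coef U b sigma r slo shi lambda v x).
Local Notation adm_int := (adm_int U b sigma r slo shi lambda v x).
Local Notation weight := (gibbs_weight psi lambda).
Local Notation theta_star := (theta_star U b sigma r slo shi lambda v x).

Lemma hjb_integrandE (theta : euclidean R n -> R) :
  hjb_integrand b sigma r slo shi lambda v x theta =
  entropic_payoff psi lambda theta.
Proof. by apply/funext => u; rewrite /hjb_integrand /entropic_payoff /Psi; ring. Qed.

Lemma measurable_sigma2 : measurable_fun U (fun u => sigma x u ^+ 2).
Proof. exact: measurable_funX. Qed.

Lemma measurable_Psi : measurable_fun U psi.
Proof.
apply: measurable_funD; last exact: measurable_funM.
apply: measurable_funD => //; apply: measurable_funM => //.
exact: measurable_sigma2.
Qed.

Lemma measurable_theta_ln (theta : euclidean R n -> R) : measurable_fun U theta ->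
  measurable_fun U (fun u => theta u * ln (theta u)).
Proof. by move=> mt; apply: measurable_funM => //; exact: measurableT_comp. Qed.

Lemma integral_defined_integrable (f : euclidean R n -> R) :
  mu.-integrable U (EFin \o f) -> integral_defined U f.
Proof.
move=> If; split; first by apply/measurable_EFinP; exact: measurable_int If.
by left; apply: integrable_lty => //; exact: integrable_funrpos.
Qed.

(** A finite sum of extended reals has finite terms. These are integrals already multiplied by real
    constants, some of which may be zero, so [integrable_scale] is applied to each product before
    linearity. *)
Lemma hjb_coef_fin_num (theta : euclidean R n -> R) : density U theta ->
  J_coef theta \is a fin_num ->
  mu.-integrable U (EFin \o hjb_integrand b sigma r slo shi lambda v x theta) /\
  J_int theta = J_coef theta.
Proof.
move=> [mt t0 it]; rewrite /hjb_coef 3!fin_numD fin_numN.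
(* Squaring undoes [sqrte] only for a nonnegative integral, which follows from [theta] being a.e.
   nonnegative on [U]. *)
have -> : (tilde_sigma U sigma x theta ^+ 2 =
    \int[mu]_(u in U) (sigma x u ^+ 2 * theta u)%:E)%E.
  rewrite sqr_sqrte//.
  rewrite -(integral0 mu U); apply: ae_le_integral => //.
    by apply/measurable_EFinP/measurable_funM => //; exact: measurable_sigma2.
  apply: filterS t0 => u /= t0 Uu; rewrite lee_fin; apply: mulr_ge0; [exact: sqr_ge0|exact: t0].
move=> /andP[/andP[/andP[fr fe] fs] fb]; rewrite muleC in fe.
have mrt : measurable_fun U (fun u => r x u * theta u) by exact: measurable_funM.
have mst : measurable_fun U (fun u => sigma x u ^+ 2 * theta u).
  by apply: measurable_funM => //; exact: measurable_sigma2.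
have mbt : measurable_fun U (fun u => b x u * theta u) by exact: measurable_funM.
have Ir := integrable_of_integral_fin_num _ mU mrt fr.
have [Ie eE] := integrable_scale _ _ mU (measurable_theta_ln _ mt) fe.
have [Is sE] := integrable_scale _ _ mU mst fs.
have [Ib bE] := integrable_scale _ _ mU mbt fb.
have hE : EFin \o hjb_integrand b sigma r slo shi lambda v x theta =
    (fun u => (r x u * theta u)%:E - (theta u * ln (theta u) * lambda)%:E
      + (sigma x u ^+ 2 * theta u * G)%:E + (b x u * theta u * derive1 v x)%:E)%E.
  apply/funext => u /=; rewrite -!EFinD /hjb_integrand.
  by congr EFin; ring.
have I1 := integrableB mU Ir Ie.
have I2 := integrableD mU I1 Is.
have I3 := integrableD mU I2 Ib.
rewrite /hjb_int; split; first by rewrite hE.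
rewrite -[LHS]/(\int[mu]_(u in U) (EFin \o _) u)%E hE.
rewrite (integralD mU I2 Ib) (integralD mU I1 Is) (integralB mU Ir Ie).
by rewrite eE sE bE [in RHS]muleC.
Qed.

(** All four terms are finite here, so no sum is of the form oo - oo and [hjb_coef_fin_num] applies.
    This criterion is meant for the truncated densities. *)
Lemma adm_of_integrable (theta : euclidean R n -> R) : density U theta ->
  mu.-integrable U (EFin \o (fun u => r x u * theta u)) ->
  mu.-integrable U (EFin \o (fun u => theta u * ln (theta u))) ->
  mu.-integrable U (EFin \o (fun u => sigma x u ^+ 2 * theta u)) ->
  mu.-integrable U (EFin \o (fun u => b x u * theta u)) ->
  [/\ adm_coef theta, adm_int theta & J_int theta = J_coef theta].
Proof.
move=> dt Ir Ie Is Ib.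
have fr : tilde_r U r x theta \is a fin_num by exact: integrable_fin_num Ir.
have fe : (- (lambda%:E * int_theta_ln_theta U theta))%E \is a fin_num.
  by rewrite fin_numN fin_numM//; exact: integrable_fin_num Ie.
have fs : (tilde_sigma U sigma x theta ^+ 2 * G%:E)%E \is a fin_num.
  rewrite fin_numM// fin_numX//.
  have [s0|s0] := leP 0%E (\int[mu]_(u in U) (sigma x u ^+ 2 * theta u)%:E)%E.
    by rewrite /tilde_sigma sqrte_fin_num//; exact: integrable_fin_num Is.
  rewrite /tilde_sigma; have := integrable_fin_num mU Is.
  by case: (\int[mu]_(u in U) _)%E.
have fb : (tilde_b U b x theta * (derive1 v x)%:E)%E \is a fin_num.
  by rewrite fin_numM//; exact: integrable_fin_num Ib.
have [|Ih hE] := hjb_coef_fin_num _ dt.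
  by rewrite /hjb_coef 3!fin_numD fr fe fs fb.
split => //; split => //; last exact: integral_defined_integrable.
split; try exact: integral_defined_integrable.
by apply/and3P; split; exact: fin_num_adde_defl.
Qed.

Lemma integral_defined_ae_eq (f g : euclidean R n -> R) : measurable_fun U g ->
  {ae mu, forall u, U u -> f u = g u} ->
  integral_defined U f -> integral_defined U g.
Proof.
move=> mg fg [mf If]; split => //.
suff [<- <-] : (\int[mu]_(u in U) (f^\+ u)%:E = \int[mu]_(u in U) (g^\+ u)%:E)%E /\
  (\int[mu]_(u in U) (f^\- u)%:E = \int[mu]_(u in U) (g^\- u)%:E)%E by [].
split; apply: ae_eq_integral => //.
- exact/measurable_EFinP/measurable_funrpos.
- exact/measurable_EFinP/measurable_funrpos.
- by apply: filterS fg => u fg Uu; rewrite /funrpos fg.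
- exact/measurable_EFinP/measurable_funrneg.
- exact/measurable_EFinP/measurable_funrneg.
- by apply: filterS fg => u fg Uu; rewrite /funrneg fg.
Qed.

(** Each ingredient is an integral over [U], hence blind to null sets. This passes admissibility
    from a given maximizer to [theta_star], whose separate integrals are not estimated directly. *)
Lemma adm_coef_ae_eq (theta theta' : euclidean R n -> R) : density U theta' ->
  {ae mu, forall u, U u -> theta u = theta' u} -> adm_coef theta ->
  adm_coef theta' /\ J_coef theta' = J_coef theta.
Proof.
move=> dt' tt' [dt ct].
have [mt _ _] := dt; have [mt' _ _] := dt'.
have eqr : {ae mu, forall u, U u -> r x u * theta u = r x u * theta' u}.
  by apply: filterS tt' => u /[apply] ->.
have eqe : {ae mu, forall u, U u ->
    theta u * ln (theta u) = theta' u * ln (theta' u)}.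
  by apply: filterS tt' => u /[apply] ->.
have eqs : {ae mu, forall u, U u ->
    sigma x u ^+ 2 * theta u = sigma x u ^+ 2 * theta' u}.
  by apply: filterS tt' => u /[apply] ->.
have eqb : {ae mu, forall u, U u -> b x u * theta u = b x u * theta' u}.
  by apply: filterS tt' => u /[apply] ->.
have int_eq (f g : euclidean R n -> R) : measurable_fun U f ->
    measurable_fun U g -> {ae mu, forall u, U u -> f u = g u} ->
    (\int[mu]_(u in U) (f u)%:E = \int[mu]_(u in U) (g u)%:E)%E.
  move=> mf mg fg; apply: ae_eq_integral => //; try exact/measurable_EFinP.
  by apply: filterS fg => u fg /fg ->.
have ms := measurable_sigma2.
have mr1 := measurable_funM mr mt; have mr2 := measurable_funM mr mt'.
have me1 := measurable_theta_ln _ mt; have me2 := measurable_theta_ln _ mt'.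
have ms1 := measurable_funM ms mt; have ms2 := measurable_funM ms mt'.
have mb1 := measurable_funM mb mt; have mb2 := measurable_funM mb mt'.
have Er : tilde_r U r x theta = tilde_r U r x theta' by exact: int_eq.
have Ee : int_theta_ln_theta U theta = int_theta_ln_theta U theta' by exact: int_eq.
have Es : tilde_sigma U sigma x theta = tilde_sigma U sigma x theta'.
  by congr sqrte; exact: int_eq.
have Eb : tilde_b U b x theta = tilde_b U b x theta' by exact: int_eq.
split; last by rewrite /hjb_coef Er Ee Es Eb.
split => //; move: ct; rewrite /coef_defined Er Ee Es Eb => -[dr de ds db cc].
split => //.
- exact: integral_defined_ae_eq dr.
- exact: integral_defined_ae_eq de.
- exact: integral_defined_ae_eq ds.
- exact: integral_defined_ae_eq db.
Qed.

(** * Truncation to sets of finite measure with bounded coefficients *)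

Definition coef_size (u : euclidean R n) : R :=
  `|r x u| + sigma x u ^+ 2 + `|b x u|.

Lemma measurable_coef_size : measurable_fun U coef_size.
Proof.
apply: measurable_funD; last exact: measurableT_comp.
by apply: measurable_funD; [exact: measurableT_comp | exact: measurable_sigma2].
Qed.

Lemma Psi_bound (c : R) (u : euclidean R n) : coef_size u <= c ->
  `|psi u| <= c * (1 + `|G| + `|derive1 v x|).
Proof.
rewrite /coef_size => uc.
have hr := normr_ge0 (r x u); have hs := sqr_ge0 (sigma x u).
have hb := normr_ge0 (b x u).
rewrite /Psi (le_trans (ler_normD _ _))// (le_trans (lerD (ler_normD _ _) (lexx _)))//.
rewrite (normrM (_ ^+ 2)) (normrM (b x u)) (ger0_norm hs) !mulrDr mulr1.
by apply: lerD; [apply: lerD; first lra |]; apply: ler_wpM2r => //; lra.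
Qed.

Section truncation.
Variables (E : set (euclidean R n)) (k : R).
Hypotheses (mE : measurable E) (EU : E `<=` U) (muE : (mu E < +oo)%E).
Hypothesis Ek : forall u, E u -> coef_size u <= k.

Let psi_max := k * (1 + `|G| + `|derive1 v x|).
Let weight_max := expR (lambda^-1 * psi_max).

Let weight_le u : E u -> weight u <= weight_max.
Proof.
move=> /Ek/Psi_bound; rewrite ler_norml => /andP[_ le].
by rewrite ler_expR ler_pM2l// invr_gt0.
Qed.

Lemma integral_truncated_weight_lty :
  (\int[mu]_(u in E) (weight u)%:E < +oo)%E.
Proof.
have mw := measurable_gibbs_weight U psi lambda measurable_Psi.
have I : mu.-integrable E (EFin \o weight).
  apply: (integrable_bounded_support _ weight_max mE mE) => //.
    by apply: measurable_funS mw.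
  move=> u Eu; rewrite indicE mem_set// mulr1 ger0_norm ?weight_le//.
  exact/ltW/gibbs_weight_gt0.
by have := integrable_fin_num mE I; rewrite fin_numElt => /andP[].
Qed.

(** On [E] the density, its logarithm and the coefficients are all bounded, and [E] has finite
    measure, so all four products are integrable. The payoff is [lambda * ln c] times the density,
    which gives the value. *)
Lemma truncated_gibbs_adm (c : R) : 0 < c ->
  (\int[mu]_(u in E) (weight u)%:E = c%:E)%E ->
  let theta := fun u => weight u / c * \1_E u in
  [/\ adm_coef theta, adm_int theta, J_int theta = J_coef theta &
      J_int theta = (lambda * ln c)%:E].
Proof.
move=> c0 intE theta.
have mw := measurable_gibbs_weight U psi lambda measurable_Psi.
have mt : measurable_fun U theta.
  apply: measurable_funM; first exact: measurable_funM.
  exact: measurable_indic.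
have t0 u : 0 <= theta u.
  rewrite mulr_ge0 ?indicE ?ler0n// divr_ge0 ?(ltW c0)//.
  exact/ltW/gibbs_weight_gt0.
have it : (\int[mu]_(u in U) (theta u)%:E = 1)%E.
  exact: (integral_gibbs_weight_restrict mu U psi lambda mU measurable_Psi).
have dt : density U theta by split => //; apply: aeW => u _; exact: t0.
have tE u : E u -> `|theta u| <= weight_max / c.
  move=> Eu; rewrite ger0_norm// /theta indicE mem_set// mulr1.
  by rewrite ler_pM2r ?invr_gt0// weight_le.
have Ibound (f : euclidean R n -> R) (m : R) : measurable_fun U f ->
    (forall u, E u -> `|f u| <= m) ->
    mu.-integrable U (EFin \o (fun u => f u * theta u)).
  move=> mf fm.
  apply: (integrable_bounded_support _ (m * (weight_max / c)) mU mE) => //.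
    exact: measurable_funM.
  move=> u Uu; rewrite indicE; have [uE|uE] := boolP (u \in E).
    by rewrite mulr1 normrM ler_pM// ?fm ?tE//; exact/set_mem.
  by rewrite /theta indicE (negbTE uE) !mulr0 normr0.
have size_le u : E u -> [/\ `|r x u| <= k, `|sigma x u ^+ 2| <= k & `|b x u| <= k].
  move=> /Ek; rewrite /coef_size (ger0_norm (sqr_ge0 _)).
  have := normr_ge0 (r x u); have := normr_ge0 (b x u).
  by have := sqr_ge0 (sigma x u) => *; split; lra.
have [|||| ac ai JJ] := adm_of_integrable theta dt.
- by apply: (Ibound _ k) => // u /size_le[].
- apply: (eq_integrable mU (EFin \o (fun u => ln (theta u) * theta u))).
    by move=> u _ /=; rewrite mulrC.
  (* On [E], [ln (theta u)] equals [lambda^-1 * psi u - ln c], and [psi_max] bounds [psi] in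
     absolute value. *)
  apply: (Ibound _ (lambda^-1 * psi_max + `|ln c|)).
    exact: measurableT_comp.
  move=> u Eu; rewrite /theta indicE mem_set// mulr1.
  rewrite ln_div ?posrE ?gibbs_weight_gt0// expRK.
  rewrite (le_trans (ler_normB _ _))// lerD2r normrM gtr0_norm ?invr_gt0//.
  by rewrite ler_pM2l ?invr_gt0//; exact/Psi_bound/Ek.
- by apply: (Ibound _ k); [exact: measurable_sigma2 | move=> u /size_le[]].
- by apply: (Ibound _ k) => // u /size_le[].
split => //; rewrite /hjb_int hjb_integrandE.
under eq_integral do rewrite entropic_payoff_gibbs//= EFinM.
rewrite integralZl//; first by rewrite it mule1.
by apply: integrable_of_integral_fin_num => //; rewrite it.
Qed.

End truncation.

(** * Finiteness of the partition function *)

Hypothesis U_gt0 : (0 < mu U)%E.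

(** The bound is asked only of densities admissible in both forms with equal objectives. The
    truncated densities are such, so the lemma serves both HJB equations. *)
Lemma weight_integral_finite (m : R) :
  (forall theta, adm_coef theta -> adm_int theta -> J_int theta = J_coef theta ->
    (J_int theta <= m%:E)%E) ->
  exists c, [/\ 0 < c, (\int[mu]_(u in U) (weight u)%:E = c%:E)%E &
    lambda * ln c <= m].
Proof.
move=> Jm.
have /sigma_finiteP[F [TF ndF Foo]] := sigma_finiteT mu.
(* [F k] gives finite measure and the sublevel set gives bounded coefficients; the union is [U]
   because [coef_size] takes real values. *)
pose E k := F k `&` (U `&` [set u | coef_size u <= k%:R]).
have mF k : measurable (F k) by have [] := Foo k.
have mE k : measurable (E k).
  apply: measurableI => //.
  rewrite -[X in measurable (_ `&` X)]/(coef_size @^-1` [set y | y <= k%:R]).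
  apply: measurable_coef_size => //.
  rewrite (_ : mkset _ = `]-oo, k%:R]%classic); first exact: measurable_itv.
  by apply/seteqP; split => y /=; rewrite in_itv.
have EU k : E k `<=` U by move=> u [_ []].
have muE k : (mu (E k) < +oo)%E.
  have [_ Fk] := Foo k; apply: le_lt_trans Fk; apply: le_measure; rewrite ?inE//.
  by move=> u [].
have Ek k u : E k u -> coef_size u <= k%:R by move=> [_ []].
have ndE : {homo E : i j / (i <= j)%N >-> (i <= j)%O}.
  move=> i j ij; apply/subsetPset => u [Fu [Uu su]]; split.
    by move: Fu; exact/subsetPset/ndF.
  by split => //=; rewrite (le_trans su)// ler_nat.
have EUT : \bigcup_k E k = U.
  apply/seteqP; split => [u [k _] /EU //|u Uu].
  have [i _ Fi] : (\bigcup_i F i) u by rewrite -TF.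
  have [j su] : exists j : nat, coef_size u <= j%:R.
    exists (Num.bound (coef_size u)); apply/ltW/archi_boundP.
    by rewrite !addr_ge0 ?sqr_ge0.
  exists (maxn i j) => //; split.
    by move: Fi; exact/subsetPset/ndF/leq_maxl.
  by split => //=; rewrite (le_trans su)// ler_nat leq_maxr.
have Zle : (\int[mu]_(u in U) (weight u)%:E <= (expR (m / lambda))%:E)%E.
  apply: (integral_gibbs_weight_le mu U psi lambda mU measurable_Psi lambda_gt0 m E) => //.
    by move=> k; apply: (integral_truncated_weight_lty (E k) k%:R) => //; exact: Ek.
  move=> k c c0 intE.
  have [ac ai JJ Jc] := truncated_gibbs_adm (E k) k%:R (mE k) (EU k) (muE k) (@Ek k) c c0 intE.
  by have := Jm _ ac ai JJ; rewrite Jc lee_fin.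
have Z0 : (0 < \int[mu]_(u in U) (weight u)%:E)%E.
  by apply: integral_gibbs_weight_gt0 => //; exact: measurable_Psi.
have Zfin : (\int[mu]_(u in U) (weight u)%:E)%E \is a fin_num.
  by rewrite gt0_fin_numE// (le_lt_trans Zle)// ltry.
exists (fine (\int[mu]_(u in U) (weight u)%:E)%E).
have c0 : 0 < fine (\int[mu]_(u in U) (weight u)%:E)%E by rewrite -lte_fin fineK.
split => //; first by rewrite fineK.
move: Zle; rewrite -(fineK Zfin) lee_fin => Zle.
by rewrite mulrC -ler_pdivlMr// -[leRHS]expRK ler_ln ?posrE ?expR_gt0.
Qed.

(** * Optimality of the normalized Gibbs density *)

Section finite_weight.
Variable c : R.
Hypotheses (c_gt0 : 0 < c).
Hypothesis intw : (\int[mu]_(u in U) (weight u)%:E = c%:E)%E.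

(** The real-valued integral in [theta_star] is the [fine] part of the extended one, which would be
    0 for an infinite integral; [intw] makes it the true normalization. *)
Lemma theta_starE u : theta_star u = weight u / c.
Proof. by rewrite /theta_star /Rintegral intw. Qed.

Lemma theta_star_density : density U theta_star.
Proof.
have E : theta_star = fun u => weight u / c by apply/funext => u; exact: theta_starE.
rewrite E; split.
- apply: measurable_funM => //; apply: measurable_gibbs_weight.
  exact: measurable_Psi.
- by apply: aeW => u _; rewrite divr_ge0 ?(ltW c_gt0)//; exact/ltW/gibbs_weight_gt0.
- have := integral_gibbs_weight_restrict mu U psi lambda mU measurable_Psi c U mU
    (@subset_refl _ U) c_gt0 intw.
  move=> <-; apply: eq_integral => u uU.
  by rewrite indicE uU mulr1.
Qed.

Lemma hjb_int_le (theta : euclidean R n -> R) : density U theta ->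
  (J_int theta <= (lambda * ln c)%:E)%E.
Proof.
move=> [mt t0 it]; rewrite /hjb_int hjb_integrandE.
by apply: integral_entropic_payoff_le => //; exact: measurable_Psi.
Qed.

Lemma hjb_int_eq (theta : euclidean R n -> R) : density U theta ->
  J_int theta = (lambda * ln c)%:E ->
  {ae mu, forall u, U u -> theta u = theta_star u}.
Proof.
move=> [mt t0 it]; rewrite /hjb_int hjb_integrandE => /integral_entropic_payoff_eq.
move=> /(_ mU measurable_Psi lambda_gt0 c_gt0 intw mt t0 it).
by apply: filterS => u /[apply] ->; rewrite theta_starE.
Qed.

(** The payoff of [theta_star] is the constant [lambda * ln c] times [theta_star] itself, so
    integrability and value both follow from its total mass 1. *)
Lemma theta_star_adm_int : adm_int theta_star /\
  J_int theta_star = (lambda * ln c)%:E.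
Proof.
have [mt t0 it] := theta_star_density.
have It : mu.-integrable U (EFin \o theta_star).
  by apply: integrable_of_integral_fin_num => //; rewrite it.
have hE : {in U, forall u,
    ((lambda * ln c)%:E * (theta_star u)%:E)%E =
    (hjb_integrand b sigma r slo shi lambda v x theta_star u)%:E}.
  move=> u uU; rewrite hjb_integrandE.
  have := entropic_payoff_gibbs psi lambda lambda_gt0 c setT u c_gt0.
  rewrite /= {1}/entropic_payoff indicT mulr1 -theta_starE -EFinM => <-.
  by [].
have Ih : mu.-integrable U
    (EFin \o hjb_integrand b sigma r slo shi lambda v x theta_star).
  by apply: (eq_integrable mU _ _ hE); exact: integrableZl.
split; first by split; [exact: theta_star_density | exact: integral_defined_integrable].
by rewrite /hjb_int -(eq_integral _ _ hE) (integralZl mU It) it mule1.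
Qed.

End finite_weight.

(** The given maximum serves to make the partition function finite. Then [theta_star] attains the
    Gibbs bound, so any other maximizer attains it as well and falls under the equality case. *)
Lemma hjb_int_maximizer (m : R) : is_max adm_int J_int m%:E ->
  ae_unique_maximizer U adm_int J_int theta_star.
Proof.
move=> [theta0 [_ max0] J0].
have [|c [c0 intw _]] := weight_integral_finite m.
  by move=> theta _ ai _; rewrite -J0; exact: max0.
have [as_ Js] := theta_star_adm_int c c0 intw.
have le theta : adm_int theta -> (J_int theta <= (lambda * ln c)%:E)%E.
  by move=> [dt _]; exact: hjb_int_le.
split; first by split => // theta; rewrite Js; exact: le.
move=> theta [at_ maxt]; apply: (hjb_int_eq c c0 intw); first by case: at_.
by apply/eqP; rewrite eq_le le//= -Js maxt.
Qed.

(** Truncation yields [lambda * ln c <= m], while a maximizer of finite value [m] has the same value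
    in the single-integral form, where the Gibbs bound gives [m <= lambda * ln c]. Thus [m] is the
    Gibbs bound and both forms have the same maximum. *)
Lemma hjb_coef_maximizer (m : R) : is_max adm_coef J_coef m%:E ->
  is_max adm_int J_int m%:E /\
  ae_unique_maximizer U adm_coef J_coef theta_star.
Proof.
move=> [theta0 [a0 max0] J0].
have [|c [c0 intw cm]] := weight_integral_finite m.
  by move=> theta ac _ ->; rewrite -J0; exact: max0.
have [as_ Js] := theta_star_adm_int c c0 intw.
have eq theta : adm_coef theta -> J_coef theta = m%:E ->
    J_int theta = m%:E /\ m = lambda * ln c.
  move=> [dt _] Jt.
  have [|_ JJ] := hjb_coef_fin_num theta dt; first by rewrite Jt.
  have mc : m <= lambda * ln c.
    by rewrite -lee_fin -Jt -JJ; exact: hjb_int_le.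
  by split; [rewrite JJ | apply/eqP; rewrite eq_le mc].
have eq_star theta : adm_coef theta -> J_coef theta = m%:E ->
    {ae mu, forall u, U u -> theta u = theta_star u}.
  move=> at_ Jt; have [Ji mE] := eq _ at_ Jt.
  by apply: (hjb_int_eq c c0 intw); [case: at_ | rewrite Ji mE].
have [_ mE] := eq _ a0 J0.
split.
  exists theta_star; last by rewrite Js mE.
  by split => // theta [dt _]; rewrite Js; exact: hjb_int_le.
(* [theta0] is a.e. equal to [theta_star], which thereby inherits its admissibility and its
   value. *)
have [acs Jcs] := adm_coef_ae_eq _ _ (theta_star_density c c0 intw)
  (eq_star _ a0 J0) a0.
split; first by split => // theta at_; rewrite Jcs; exact: max0.
move=> theta [at_ maxt]; apply: eq_star => //.
by apply/eqP; rewrite eq_le -J0 max0//= maxt.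
Qed.

End exploratory_control.

(** * From joint measurability to fixed states, and the theorem *)

Lemma measurable_section {R : realType} {d} {T : measurableType d} (U : set T)
    (f : R -> T -> R) (x : R) : measurable U ->
  measurable_fun ([set: measurableTypeR R] `*` U) (fun p => f p.1 p.2) ->
  measurable_fun U (f x).
Proof.
move=> mU mf.
apply: (@measurable_comp _ _ _ _ _ _ ([set: measurableTypeR R] `*` U)
  (fun p : measurableTypeR R * T => f p.1 p.2) U (pair (x : measurableTypeR R))) => //.
- exact: measurableX.
- by move=> _ [u Uu <-].
- exact: measurable_funTS (pair1_measurable _).
Qed.

Theorem theorem1 (R : realType) (n : nat) (U : set (euclidean R n))
    (b sigma r : R -> euclidean R n -> R) (slo shi rho lambda : R) (v : R -> R)
    (mU : measurable U) (U_pos : (0 < lebesgue_tuple n U)%E)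
    (mb : measurable_fun ([set: measurableTypeR R] `*` U) (fun p => b p.1 p.2))
    (msigma : measurable_fun ([set: measurableTypeR R] `*` U)
       (fun p => sigma p.1 p.2))
    (mr : measurable_fun ([set: measurableTypeR R] `*` U) (fun p => r p.1 p.2))
    (slo_gt0 : 0 < slo) (slo_le_shi : slo <= shi)
    (rho_gt0 : 0 < rho) (lambda_gt0 : 0 < lambda)
    (v_diff : twice_differentiable v) :
  [/\ HJB_coef U b sigma r slo shi rho lambda v ->
        HJB_int U b sigma r slo shi rho lambda v,
      HJB_coef U b sigma r slo shi rho lambda v ->
        forall x : R,
          ae_unique_maximizer U (adm_coef U b sigma r slo shi lambda v x)
            (hjb_coef U b sigma r slo shi lambda v x)
            (theta_star U b sigma r slo shi lambda v x) &
      HJB_int U b sigma r slo shi rho lambda v ->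
        forall x : R,
          ae_unique_maximizer U (adm_int U b sigma r slo shi lambda v x)
            (hjb_int U b sigma r slo shi lambda v x)
            (theta_star U b sigma r slo shi lambda v x)].
Proof.
split => [hjb x|hjb x|hjb x].
- by have [] := hjb_coef_maximizer U b sigma r slo shi lambda v x mU
    (measurable_section U b x mU mb) (measurable_section U sigma x mU msigma)
    (measurable_section U r x mU mr) lambda_gt0 U_pos _ (hjb x).
- by have [] := hjb_coef_maximizer U b sigma r slo shi lambda v x mU
    (measurable_section U b x mU mb) (measurable_section U sigma x mU msigma)
    (measurable_section U r x mU mr) lambda_gt0 U_pos _ (hjb x).
- exact: (hjb_int_maximizer U b sigma r slo shi lambda v x mU
    (measurable_section U b x mU mb) (measurable_section U sigma x mU msigma)
    (measurable_section U r x mU mr) lambda_gt0 U_pos _ (hjb x)).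
Qed.
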